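(* Let $0<|q|<1$, $0<|p|<1$, $|x|<1$, $|y|<1$. (I) Let $a,b,c,d\in\mathbb{C}$ with $p^{c}\neq p^{-n}$ and $q^{d}\ne q^{-n}$ for all integers $n\ge 0$. Then $$\Psi_{1}(q^{a},p^{b+1};p^{c},q^{d};q,p,x,y)=\Psi_{1}(q^{a},p^{b};p^{c},q^{d};q,p,x,y)+\frac{p^{b}(1-q^{a})y}{1-p^{c}}\Psi_{1}(q^{a+1},p^{b+1};p^{c+1},q^{d};q,p,x,y),$$ $$\Psi_{1}(q^{a},p^{b};p^{c},q^{d};q,p,x,y)=(1-p^{b})\Psi_{1}(q^{a},p^{b+1};p^{c},q^{d};q,p,x,y)+p^{b}\Psi_{1}(q^{a},p^{b};p^{c},q^{d};q,p,x,py),$$ and, if $p^{c-1}\neq1$, $$\Psi_{1}(q^{a},p^{b};p^{c-1},q^{d};q,p,x,y)=\Psi_{1}(q^{a},p^{b};p^{c},q^{d};q,p,x,y)+\frac{p^{c-1}(1-q^{a})(1-p^{b})y}{(1-p^{c-1})(1-p^{c})}\Psi_{1}(q^{a+1},p^{b+1};p^{c+1},q^{d};q,p,x,y).$$ (II) Let $a,b,c\in\mathbb{C}$ with $p^{b}\neq p^{-n}$ and $q^{c}\ne q^{-n}$ for all integers $n\ge 0$, and $p^{b-1}\ne 1$. Then $$\Psi_{2}(q^{a};p^{b-1},q^{c};q,p,x,y)=\Psi_{2}(q^{a};p^{b},q^{c};q,p,x,y)+\frac{p^{b-1}(1-q^{a})y}{(1-p^{b-1})(1-p^{b})}\Ps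i_{2}(q^{a+1};p^{b+1},q^{c};q,p,x,y).$$
   Context: $q,p\in\mathbb{C}$ are two independent bases with $0<|q|<1$, $0<|p|<1$; logarithms of $q$ and $p$ are fixed so that $q^{a}=e^{a\log q}$, $p^{b}=e^{b\log p}$ for complex exponents. The $q$-shifted factorial is $(A;q)_{0}=1$, $(A;q)_{k}=\prod_{r=0}^{k-1}(1-Aq^{r})$ for $k\ge1$ (similarly with base $p$). The bibasic Humbert functions are, for $|x|,|y|<1$ and whenever no denominator factor vanishes, $$\Psi_{1}(q^{a},p^{b};p^{c},q^{d};q,p,x,y)=\sum_{\ell,k=0}^{\infty}\frac{(q^{a};q)_{k+\ell}(p^{b};p)_{\ell}}{(p^{c};p)_{\ell}(q^{d};q)_{k}(q;q)_{k}(p;p)_{\ell}}x^{k}y^{\ell},$$ $$\Psi_{2}(q^{a};p^{b},q^{c};q,p,x,y)=\sum_{\ell,k=0}^{\infty}\frac{(q^{a};q)_{k+\ell}}{(p^{b};p)_{\ell}(q^{c};q)_{k}(q;q)_{k}(p;p)_{\ell}}x^{k}y^{\ell}.$$ *)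

(* Defs.v *)
From Stdlib Require Import Reals.
From Coquelicot Require Import Coquelicot.

Open Scope C_scope.

Definition Cexp (z : C) : C :=
  ((exp (Re z) * cos (Im z))%R, (exp (Re z) * sin (Im z))%R).

(* The power q^a = e^(a log q), as a function of the chosen logarithm
   [lq] of the base q, i.e. a complex number such that [Cexp lq = q]. *)
Definition bpow (lq a : C) : C := Cexp (a * lq).

(* (A;q)_k = (1 - A)(1 - A q) ... (1 - A q^(k-1)) *)
Fixpoint qpoch (A q : C) (k : nat) : C :=
  match k with
  | O => 1
  | S r => qpoch A q r * (1 - A * q ^ r)
  end.

(* Convergence of the double series to [s]: the rectangular partial sums over
   0 <= l <= L, 0 <= k <= K tend to [s] as L and K tend jointly to infinity. *)
Definition is_dseries (u : nat -> nat -> C) (s : C) : Prop :=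
  filterlim
    (fun N : nat * nat => sum_n (fun l => sum_n (fun k => u l k) (snd N)) (fst N))
    (filter_prod eventually eventually)
    (@locally C_CompleteNormedModule s).

(* Unspecified when the double series diverges. *)
Definition dseries (u : nat -> nat -> C) : C :=
  @iota C_CompleteNormedModule (is_dseries u).

Lemma is_dseries_unique (u : nat -> nat -> C) (s : C) :
  is_dseries u s -> dseries u = s.
Proof.
intros H.
exact (@iota_filterlim_locally _ C_CompleteNormedModule _ _ _ _ s H).
Qed.

(* As in the usual notation, the parameters of the Humbert functions are the
   values q^a, p^b, ... and not the exponents. *)
Definition Psi1 (A B Cc D q p x y : C) : C :=
  dseries (fun l k =>
    (qpoch A q (k + l) * qpoch B p l)
    / (qpoch Cc p l * qpoch D q k * qpoch q q k * qpoch p p l)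
    * x ^ k * y ^ l).

Definition Psi2 (A B Cc q p x y : C) : C :=
  dseries (fun l k =>
    qpoch A q (k + l)
    / (qpoch B p l * qpoch Cc q k * qpoch q q k * qpoch p p l)
    * x ^ k * y ^ l).

(* Main.v *)
(* The coefficients of the double series are bounded, because (A;q)_n and the
   reciprocal of a nonvanishing (D;q)_n are; so the series is dominated by
   M |x|^k |y|^l and can be manipulated term by term. Each identity then reduces
   to one between the coefficients of x^k y^l; the contiguous function carrying
   the factor y enters with its index l shifted by one, via
   (A;q)_(n+1) = (1 - A) (Aq;q)_n. The relation for Psi_2 is the case B = 0 of
   the third relation for Psi_1, since (0;p)_l = 1. *)
Require Import Defs.
From Stdlib Require Import Reals Lra Lia IndefiniteDescription.
From Coquelicot Require Import Coquelicot.

Open Scope C_scope.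

(** * Geometrically dominated series and double series *)

Lemma sum_n_Cmod_geom_le (a : nat -> C) (M t : R) :
  (0 <= M)%R -> (0 <= t < 1)%R -> (forall n, (Cmod (a n) <= M * t ^ n)%R) ->
  forall N, (Cmod (sum_n a N) <= M / (1 - t))%R.
Proof.
intros HM Ht Ha N.
assert (H : (Cmod (sum_n a N) <= M * ((1 - t ^ S N) / (1 - t)))%R).
{ induction N as [|N IH].
  - rewrite sum_O. eapply Rle_trans; [apply Ha|]. apply Req_le. simpl. field. lra.
  - rewrite sum_Sn. eapply Rle_trans; [apply Cmod_triangle|].
    eapply Rle_trans; [apply Rplus_le_compat; [apply IH|apply Ha]|].
    apply Req_le. simpl. field. lra. }
eapply Rle_trans; [apply H|].
apply Rmult_le_compat_l; [lra|].
rewrite <- (Rmult_1_l (/ (1 - t))).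
apply Rmult_le_compat_r; [apply Rlt_le, Rinv_0_lt_compat; lra|].
pose proof (pow_le t (S N)). lra.
Qed.

Lemma sum_n_shift (a : nat -> C) (N j : nat) :
  sum_n a (S N + j) = sum_n a N + sum_n (fun i => a (S N + i)%nat) j.
Proof.
induction j as [|j IH].
- rewrite sum_O, Nat.add_0_r, sum_Sn. reflexivity.
- rewrite Nat.add_succ_r, !sum_Sn, IH.
  change (sum_n a N + sum_n (fun i => a (S N + i)%nat) j + a (S (S N + j))
    = sum_n a N + (sum_n (fun i => a (S N + i)%nat) j + a (S N + S j)%nat)).
  rewrite Nat.add_succ_r. ring.
Qed.

(** Mere convergence would not suffice for double series: the explicit error lets the errors of the
    rows be added up over all rows. It comes from bounding finite blocks of the tail by a geometric
    sum. *)
Lemma ex_series_geom_bound (a : nat -> C) (M t : R) :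
  (0 <= M)%R -> (0 <= t < 1)%R -> (forall n, (Cmod (a n) <= M * t ^ n)%R) ->
  exists s : C, forall N, (Cmod (sum_n a N - s) <= M / (1 - t) * t ^ N)%R.
Proof.
intros HM Ht Ha.
assert (Hex : @ex_series C_AbsRing C_CompleteNormedModule a).
{ apply (@ex_series_le C_AbsRing C_CompleteNormedModule a (fun n => M * t ^ n)%R Ha).
  apply (ex_series_scal_l (V := R_NormedModule) M (fun n => t ^ n)%R).
  apply ex_series_geom. rewrite Rabs_pos_eq; lra. }
destruct Hex as [s Hs]. exists s.
assert (Hl : forall eps : R, (0 < eps)%R ->
       eventually (fun N => (Cmod (sum_n a N - s) < eps)%R)).
{ intros eps He.
  exact (proj1 (@filterlim_locally_ball_norm C_AbsRing nat C_CompleteNormedModule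
     eventually _ (sum_n a) s) Hs (mkposreal eps He)). }
intros N. apply le_epsilon. intros eps He.
destruct (Hl eps He) as [N0 HN0].
(* This index is late enough to be within [eps] of [s], and also lies past [N]; the gap between the
   two partial sums is a block [T] of [N0 + 1] terms, bounded independently of [N0]. *)
specialize (HN0 (S N + N0)%nat ltac:(lia)).
rewrite sum_n_shift in HN0.
assert (Hb : (Cmod (sum_n (fun i => a (S N + i)%nat) N0) <= (M * t ^ N) / (1 - t))%R).
{ assert (HtN := pow_le t N (proj1 Ht)).
  apply sum_n_Cmod_geom_le; [nra|lra|].
  intros n. eapply Rle_trans; [apply Ha|].
  replace (t ^ (S N + n))%R with (t * (t ^ N * t ^ n))%R
    by (rewrite pow_add; simpl; ring).
  assert (Htn := pow_le t n (proj1 Ht)).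
  assert (0 <= M * (t ^ N * t ^ n))%R by (repeat apply Rmult_le_pos; assumption).
  nra. }
set (T := sum_n (fun i => a (S N + i)%nat) N0) in *.
replace (sum_n a N - s) with ((sum_n a N + T - s) + - T) by ring.
eapply Rle_trans; [apply Cmod_triangle|]. rewrite Cmod_opp.
replace (M / (1 - t) * t ^ N)%R with ((M * t ^ N) / (1 - t))%R by (field; lra).
lra.
Qed.

Lemma eventually_geom_lt (c t eps : R) :
  (0 <= t < 1)%R -> (0 < eps)%R -> eventually (fun n => (c * t ^ n < eps)%R).
Proof.
intros Ht He.
assert (H : is_lim_seq (fun n => (c * t ^ n)%R) (c * 0)%R).
{ apply (is_lim_seq_scal_l _ c 0). apply is_lim_seq_geom. rewrite Rabs_pos_eq; lra. }
rewrite Rmult_0_r in H.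
apply is_lim_seq_spec in H. destruct (H (mkposreal eps He)) as [N HN].
exists N. intros n Hn. specialize (HN n Hn). simpl in HN.
rewrite Rminus_0_r in HN. apply Rabs_def2 in HN. lra.
Qed.

(** Row [l], cut at [K], misses its sum [r l] by at most a constant times [X ^ K * Y ^ l]. Summed
    over [l <= L] this error is of order [X ^ K] uniformly in [L], while the row sums [r l]
    themselves form a geometrically dominated series. Hence the limit in [L] and [K] is joint. *)
Lemma ex_dseries_geom_bound (u : nat -> nat -> C) (M X Y : R) :
  (0 <= M)%R -> (0 <= X < 1)%R -> (0 <= Y < 1)%R ->
  (forall l k, (Cmod (u l k) <= M * X ^ k * Y ^ l)%R) ->
  exists s, is_dseries u s.
Proof.
intros HM HX HY Hu.
assert (HMX : (0 <= M / (1 - X))%R).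
{ apply Rmult_le_pos; [lra|apply Rlt_le, Rinv_0_lt_compat; lra]. }
assert (Hrow : forall l, exists r : C, forall N,
  (Cmod (sum_n (u l) N - r) <= M / (1 - X) * X ^ N * Y ^ l)%R).
{ intros l. assert (HYl := pow_le Y l (proj1 HY)).
  destruct (ex_series_geom_bound (u l) (M * Y ^ l) X) as [r Hr].
  - nra.
  - lra.
  - intros n. replace (M * Y ^ l * X ^ n)%R with (M * X ^ n * Y ^ l)%R by ring. apply Hu.
  - exists r. intros N. specialize (Hr N).
    replace (M / (1 - X) * X ^ N * Y ^ l)%R with (M * Y ^ l / (1 - X) * X ^ N)%R
      by (field; lra). exact Hr. }
destruct (functional_choice _ Hrow) as [r Hr].
(* The constant bounds [r l] through its first term: [M] for [u l 0], and [M / (1 - X)] for the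
   error of the partial sum at index 0. *)
destruct (ex_series_geom_bound r (M + M / (1 - X)) Y) as [s Hs].
{ lra. }
{ lra. }
{ intros l. specialize (Hr l O). specialize (Hu l O).
  rewrite sum_O in Hr. simpl in Hr, Hu.
  replace (r l) with (u l O + - (u l O - r l)) by ring.
  eapply Rle_trans; [apply Cmod_triangle|]. rewrite Cmod_opp. lra. }
exists s.
apply (@filterlim_locally_ball_norm C_AbsRing _ C_CompleteNormedModule).
{ apply filter_prod_filter; apply eventually_filter. }
intros eps.
destruct (eventually_geom_lt ((M + M / (1 - X)) / (1 - Y)) Y (eps / 2)) as [L0 HL];
  [lra|destruct eps; simpl; lra|].
destruct (eventually_geom_lt (M / (1 - X) / (1 - Y)) X (eps / 2)) as [K0 HK];
  [lra|destruct eps; simpl; lra|].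
exists (fun L => (L0 <= L)%nat) (fun K => (K0 <= K)%nat).
{ exists L0; auto. }
{ exists K0; auto. }
intros L K HL0 HK0.
change (Cmod (sum_n (fun l => sum_n (u l) K) L - s) < eps)%R.
assert (Hd : (Cmod (sum_n (fun l => sum_n (u l) K - r l)%C L)
              <= M / (1 - X) * X ^ K / (1 - Y))%R).
{ apply sum_n_Cmod_geom_le; [|lra|intros l; apply Hr].
  apply Rmult_le_pos; [lra|apply pow_le; lra]. }
assert (He : sum_n (fun l => sum_n (u l) K) L
  = sum_n (fun l => sum_n (u l) K - r l) L + sum_n r L).
{ rewrite <- (sum_n_plus (G := C_AbelianMonoid)). apply sum_n_ext. intros l.
  change ((sum_n (u l) K : C) = (sum_n (u l) K : C) - r l + r l). ring. }
rewrite He.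
set (T := sum_n (fun l => sum_n (u l) K - r l) L) in *.
replace (T + sum_n r L - s) with (T + (sum_n r L - s)) by ring.
eapply Rle_lt_trans; [apply Cmod_triangle|].
specialize (HL L HL0). specialize (HK K HK0). specialize (Hs L).
replace (M / (1 - X) * X ^ K / (1 - Y))%R
  with (M / (1 - X) / (1 - Y) * X ^ K)%R in Hd by (field; lra).
lra.
Qed.

(** * Termwise operations on double series *)

Lemma is_dseries_ext (u v : nat -> nat -> C) (s : C) :
  (forall l k, u l k = v l k) -> is_dseries u s -> is_dseries v s.
Proof.
intros H. apply filterlim_ext. intros N.
apply sum_n_ext; intros l; apply sum_n_ext; intros k; apply H.
Qed.

Lemma is_dseries_plus (u v : nat -> nat -> C) (s t : C) :
  is_dseries u s -> is_dseries v t -> is_dseries (fun l k => u l k + v l k) (s + t).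
Proof.
intros Hu Hv.
eapply filterlim_ext;
  [|eapply filterlim_comp_2; [exact Hu|exact Hv|
    exact (@filterlim_plus C_AbsRing C_CompleteNormedModule s t)]].
intros N. cbv beta.
rewrite <- sum_n_plus. apply sum_n_ext; intros l.
rewrite <- sum_n_plus. apply sum_n_ext; reflexivity.
Qed.

Lemma is_dseries_scal (u : nat -> nat -> C) (c s : C) :
  is_dseries u s -> is_dseries (fun l k => c * u l k) (c * s).
Proof.
intros Hu.
eapply filterlim_ext;
  [|exact (filterlim_comp _ _ _ _ _ _ _ _ Hu
      (@filterlim_scal_r C_AbsRing C_CompleteNormedModule c s))].
intros N. symmetry.
etransitivity; [|apply (sum_n_mult_l (K := C_Ring) c)].
apply sum_n_ext; intros l. apply (sum_n_mult_l (K := C_Ring) c).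
Qed.

(** Models multiplication by y at the level of coefficients: the coefficient of y^m moves to
    y^(m+1), and row 0 becomes empty. *)
Definition shift_rows (u : nat -> nat -> C) (l k : nat) : C :=
  match l with O => 0 | S m => u m k end.

(** The rectangular sum of the shifted family up to row [S L] equals that of [u] up to row [L], so
    only the threshold on rows moves, by one. *)
Lemma is_dseries_shift_rows (u : nat -> nat -> C) (s : C) :
  is_dseries u s -> is_dseries (shift_rows u) s.
Proof.
intros Hu P HP.
destruct (Hu P HP) as [Q R HQ HR HQR].
destruct HQ as [L0 HQ].
exists (fun L => (S L0 <= L)%nat) R; [exists (S L0); auto|exact HR|].
intros [|L] K HL HK; [lia|]. simpl.
assert (E : sum_n (fun l => sum_n (fun k => shift_rows u l k) K) (S L)
   = sum_n (fun l => sum_n (fun k => u l k) K) L).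
{ clear.
  assert (E0 : sum_n (fun k => shift_rows u 0 k) K = (0 : C)).
  { induction K as [|K IH]; [apply sum_O|].
    rewrite sum_Sn, IH. simpl. apply (plus_zero_l (G := C_AbelianMonoid)). }
  induction L as [|L IH].
  - rewrite sum_Sn, !sum_O, E0. apply (plus_zero_l (G := C_AbelianMonoid)).
  - rewrite sum_Sn, IH, sum_Sn. reflexivity. }
unfold filtermap in HQR. simpl in HQR.
rewrite E. apply HQR; [apply HQ; lia|exact HK].
Qed.

(** * Bounds for q-shifted factorials and convergence of Psi_1 *)

Lemma bounded_of_growth (f : nat -> C) (K t : R) :
  (0 <= K)%R -> (0 <= t < 1)%R ->
  (forall n, (Cmod (f (S n)) <= Cmod (f n) * (1 + K * t ^ n))%R) ->
  exists M, forall n, (Cmod (f n) <= M)%R.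
Proof.
intros HK Ht Hf.
(* Since 1 + z <= exp z, the growth factors multiply to at most the exponential of the geometric sum
   of the [K * t ^ n]. *)
exists (Cmod (f O) * exp (K / (1 - t)))%R. intros n.
assert (H : (Cmod (f n) <= Cmod (f O) * exp (K * ((1 - t ^ n) / (1 - t))))%R).
{ induction n as [|n IH].
  - simpl. replace (K * ((1 - 1) / (1 - t)))%R with 0%R by (field; lra).
    rewrite exp_0. lra.
  - assert (Htn := pow_le t n (proj1 Ht)).
    eapply Rle_trans; [apply Hf|].
    replace (K * ((1 - t ^ S n) / (1 - t)))%R
      with (K * ((1 - t ^ n) / (1 - t)) + K * t ^ n)%R by (simpl; field; lra).
    rewrite exp_plus, <- Rmult_assoc.
    apply Rmult_le_compat; [apply Cmod_ge_0|nra|exact IH|apply exp_ineq1_le]. }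
eapply Rle_trans; [exact H|].
apply Rmult_le_compat_l; [apply Cmod_ge_0|].
assert (Hle : (K * ((1 - t ^ n) / (1 - t)) <= K / (1 - t))%R).
{ assert (Htn := pow_le t n (proj1 Ht)).
  assert (Hi : (0 < / (1 - t))%R) by (apply Rinv_0_lt_compat; lra).
  unfold Rdiv. rewrite <- Rmult_assoc. apply Rmult_le_compat_r; nra. }
destruct Hle as [Hle|Hle]; [apply Rlt_le, exp_increasing, Hle|rewrite Hle; lra].
Qed.

Lemma qpoch_bounded (A q : C) :
  (Cmod q < 1)%R -> exists M, forall n, (Cmod (qpoch A q n) <= M)%R.
Proof.
intros Hq.
apply (bounded_of_growth _ (Cmod A) (Cmod q)).
- apply Cmod_ge_0.
- split; [apply Cmod_ge_0|exact Hq].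
- intros n. simpl. rewrite Cmod_mult.
  apply Rmult_le_compat_l; [apply Cmod_ge_0|].
  eapply Rle_trans; [apply Cmod_triangle|].
  rewrite Cmod_opp, Cmod_mult, Cmod_pow, Cmod_1. lra.
Qed.

(** As A q^n tends to 0, all but finitely many factors have modulus at least 1/2, so their inverses
    are bounded by 2; the remaining finitely many inverses are bounded by their maximum. *)
Lemma inv_factor_bounded (A q : C) :
  (Cmod q < 1)%R -> (forall n, 1 - A * q ^ n <> 0) ->
  exists M, forall n, (Cmod (/ (1 - A * q ^ n)) <= M)%R.
Proof.
intros Hq HA.
destruct (eventually_geom_lt (Cmod A) (Cmod q) (1 / 2)) as [N HN];
  [split; [apply Cmod_ge_0|exact Hq]|lra|].
assert (Hfin : forall N, exists M, forall n, (n < N)%nat ->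
          (Cmod (/ (1 - A * q ^ n)) <= M)%R).
{ clear N HN. intros N. induction N as [|N [M HM]]; [exists 0%R; lia|].
  exists (Rmax M (Cmod (/ (1 - A * q ^ N)))). intros n Hn.
  destruct (Nat.eq_dec n N) as [->|]; [apply Rmax_r|].
  eapply Rle_trans; [apply HM; lia|apply Rmax_l]. }
destruct (Hfin N) as [M HM]. exists (Rmax M 2). intros n.
destruct (Nat.lt_ge_cases n N) as [Hn|Hn].
- eapply Rle_trans; [apply HM, Hn|apply Rmax_l].
- eapply Rle_trans; [|apply Rmax_r].
  rewrite Cmod_inv by apply HA.
  specialize (HN n Hn).
  assert (H1 : (1 <= Cmod (1 - A * q ^ n) + Cmod A * Cmod q ^ n)%R).
  { rewrite <- Cmod_pow, <- Cmod_mult.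
    eapply Rle_trans; [|apply Cmod_triangle].
    replace (1 - A * q ^ n + A * q ^ n) with (RtoC 1) by ring.
    rewrite Cmod_1. lra. }
  replace 2%R with (/ (1 / 2))%R by field.
  apply Rinv_le_contravar; lra.
Qed.

Lemma qpoch_neq_0 (A q : C) :
  (forall n, 1 - A * q ^ n <> 0) -> forall n, qpoch A q n <> 0.
Proof.
intros HA n. induction n as [|n IH]; simpl; [exact C1_nz|].
apply Cmult_neq_0; auto.
Qed.

(* 1/(1 - z) = 1 + z/(1 - z) bounds the growth of the reciprocal. *)
Lemma inv_qpoch_bounded (A q : C) :
  (Cmod q < 1)%R -> (forall n, 1 - A * q ^ n <> 0) ->
  exists M, forall n, (Cmod (/ qpoch A q n) <= M)%R.
Proof.
intros Hq HA.
destruct (inv_factor_bounded A q Hq HA) as [K HK].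
assert (HK0 : (0 <= K)%R).
{ eapply Rle_trans; [apply Cmod_ge_0|apply (HK O)]. }
assert (HA0 := Cmod_ge_0 A).
apply (bounded_of_growth _ (Cmod A * K) (Cmod q)).
- nra.
- split; [apply Cmod_ge_0|exact Hq].
- intros n. assert (Hn := qpoch_neq_0 A q HA n).
  simpl.
  replace (/ (qpoch A q n * (1 - A * q ^ n)))
    with (/ qpoch A q n * (1 + A * q ^ n * / (1 - A * q ^ n)))
    by (field; split; [apply HA|exact Hn]).
  rewrite Cmod_mult. apply Rmult_le_compat_l; [apply Cmod_ge_0|].
  eapply Rle_trans; [apply Cmod_triangle|].
  rewrite Cmod_1, !Cmod_mult, Cmod_pow.
  apply Rplus_le_compat_l.
  replace (Cmod A * K * Cmod q ^ n)%R with (Cmod A * Cmod q ^ n * K)%R by ring.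
  apply Rmult_le_compat_l; [|apply HK].
  apply Rmult_le_pos; [exact HA0|apply pow_le, Cmod_ge_0].
Qed.

Lemma one_minus_pow_neq_0 (q : C) :
  (Cmod q < 1)%R -> forall n, 1 - q * q ^ n <> 0.
Proof.
intros Hq n H.
assert (E : q ^ S n = 1).
{ simpl. replace (q * q ^ n) with (1 - (1 - q * q ^ n)) by ring. rewrite H. ring. }
apply (f_equal Cmod) in E. rewrite Cmod_pow, Cmod_1 in E.
assert (H1 := pow_lt_1_compat (Cmod q) (S n)
  (conj (Cmod_ge_0 q) Hq) (Nat.lt_0_succ n)).
lra.
Qed.

Lemma qpoch_Sl (A q : C) (n : nat) :
  qpoch A q (S n) = (1 - A) * qpoch (A * q) q n.
Proof.
induction n as [|n IH]; [simpl; ring|].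
change (qpoch A q (S n) * (1 - A * q ^ S n)
  = (1 - A) * (qpoch (A * q) q n * (1 - A * q * q ^ n))).
rewrite IH. simpl. ring.
Qed.

(** [Psi1] is a meaningful value only once its series is known to converge. Two numerator factors
    and four reciprocals are each bounded, and the product of the six bounds is the constant of a
    geometric majorant. *)
Lemma is_dseries_Psi1 (A B Cc D q p x y : C) :
  (Cmod q < 1)%R -> (Cmod p < 1)%R -> (Cmod x < 1)%R -> (Cmod y < 1)%R ->
  (forall n, 1 - Cc * p ^ n <> 0) -> (forall n, 1 - D * q ^ n <> 0) ->
  is_dseries (fun l k =>
    (qpoch A q (k + l) * qpoch B p l)
    / (qpoch Cc p l * qpoch D q k * qpoch q q k * qpoch p p l)
    * x ^ k * y ^ l) (Psi1 A B Cc D q p x y).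
Proof.
intros Hq Hp Hx Hy HC HD.
assert (Hqq := one_minus_pow_neq_0 q Hq).
assert (Hpp := one_minus_pow_neq_0 p Hp).
destruct (qpoch_bounded A q Hq) as [M1 H1].
destruct (qpoch_bounded B p Hp) as [M2 H2].
destruct (inv_qpoch_bounded Cc p Hp HC) as [M3 H3].
destruct (inv_qpoch_bounded D q Hq HD) as [M4 H4].
destruct (inv_qpoch_bounded q q Hq Hqq) as [M5 H5].
destruct (inv_qpoch_bounded p p Hp Hpp) as [M6 H6].
assert (Hpos : forall (f : nat -> C) M, (forall n, (Cmod (f n) <= M)%R) -> (0 <= M)%R).
{ intros f M H. eapply Rle_trans; [apply Cmod_ge_0|apply (H O)]. }
assert (P1 := Hpos _ _ H1). assert (P2 := Hpos _ _ H2).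
assert (P3 := Hpos _ _ H3). assert (P4 := Hpos _ _ H4).
assert (P5 := Hpos _ _ H5). assert (P6 := Hpos _ _ H6).
match goal with |- is_dseries ?u _ => enough (Hex : exists s, is_dseries u s) end.
{ destruct Hex as [s Hs]. unfold Psi1. rewrite (is_dseries_unique _ _ Hs). exact Hs. }
apply (ex_dseries_geom_bound _ (M1 * M2 * (M3 * M4 * M5 * M6)) (Cmod x) (Cmod y)).
- repeat apply Rmult_le_pos; assumption.
- split; [apply Cmod_ge_0|exact Hx].
- split; [apply Cmod_ge_0|exact Hy].
- intros l k.
  replace (qpoch A q (k + l) * qpoch B p l
    / (qpoch Cc p l * qpoch D q k * qpoch q q k * qpoch p p l) * x ^ k * y ^ l)
  with (qpoch A q (k + l) * qpoch B p l
    * (/ qpoch Cc p l * / qpoch D q k * / qpoch q q k * / qpoch p p l) * x ^ k * y ^ l)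
  by (field; repeat split; apply qpoch_neq_0; assumption).
  rewrite !(Cmod_mult _ (_ ^ _)), !Cmod_pow.
  apply Rmult_le_compat_r; [apply pow_le, Cmod_ge_0|].
  apply Rmult_le_compat_r; [apply pow_le, Cmod_ge_0|].
  rewrite !Cmod_mult.
  repeat apply Rmult_le_compat;
    repeat apply Rmult_le_pos; try apply Cmod_ge_0; auto.
Qed.

(** * Contiguous relations for Psi_1 *)

Lemma shift_nonvanishing (A q : C) :
  (forall n, 1 - A * q ^ n <> 0) -> forall n, 1 - A * q * q ^ n <> 0.
Proof.
intros H n E. apply (H (S n)). rewrite <- E. simpl. ring.
Qed.

(** The coefficients agree because (Bp;p)_(l+1) - (B;p)_(l+1) = B (1 - p^(l+1)) (Bp;p)_l, and 1 -
    p^(l+1) cancels the last factor of (p;p)_(l+1). *)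
Lemma Psi1_shift_B (A B Cc D q p x y : C) :
  (Cmod q < 1)%R -> (Cmod p < 1)%R -> (Cmod x < 1)%R -> (Cmod y < 1)%R ->
  (forall n, 1 - Cc * p ^ n <> 0) -> (forall n, 1 - D * q ^ n <> 0) ->
  Psi1 A (B * p) Cc D q p x y
  = Psi1 A B Cc D q p x y
    + B * (1 - A) * y / (1 - Cc) * Psi1 (A * q) (B * p) (Cc * p) D q p x y.
Proof.
intros Hq Hp Hx Hy HC HD.
assert (Hqq := one_minus_pow_neq_0 q Hq).
assert (Hpp := one_minus_pow_neq_0 p Hp).
assert (HC' := shift_nonvanishing Cc p HC).
assert (HC0 : 1 - Cc <> 0).
{ intros E. apply (HC O). simpl. rewrite <- E. ring. }
apply is_dseries_unique.
eapply is_dseries_ext; [|apply is_dseries_plus;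
  [apply is_dseries_Psi1; assumption
  |apply is_dseries_scal, is_dseries_shift_rows, is_dseries_Psi1; assumption]].
intros l k. cbv beta.
assert (N1 := qpoch_neq_0 D q HD k).
assert (N2 := qpoch_neq_0 q q Hqq k).
destruct l as [|l]; unfold shift_rows; [simpl; ring|].
(* The symbols in [A], [B] and [Cc] lose their first factor, whereas [simpl] below takes the last
   factor off (Bp;p)_(l+1) and (p;p)_(l+1); both sides are then written in the same symbols. *)
rewrite Nat.add_succ_r, (qpoch_Sl A), (qpoch_Sl B), (qpoch_Sl Cc).
assert (N3 := qpoch_neq_0 p p Hpp l).
assert (N4 := qpoch_neq_0 (Cc * p) p HC' l).
specialize (Hpp l).
simpl. field. repeat split; assumption.
Qed.

(** Replacing y by py multiplies the coefficient by p^l, and (1 - B) (Bp;p)_l = (B;p)_l (1 - B p^l);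
    the two contributions add up since (1 - B p^l) + B p^l = 1. *)
Lemma Psi1_split_B (A B Cc D q p x y : C) :
  (Cmod q < 1)%R -> (Cmod p < 1)%R -> (Cmod x < 1)%R -> (Cmod y < 1)%R ->
  (forall n, 1 - Cc * p ^ n <> 0) -> (forall n, 1 - D * q ^ n <> 0) ->
  Psi1 A B Cc D q p x y
  = (1 - B) * Psi1 A (B * p) Cc D q p x y + B * Psi1 A B Cc D q p x (p * y).
Proof.
intros Hq Hp Hx Hy HC HD.
assert (Hpy : (Cmod (p * y) < 1)%R).
{ rewrite Cmod_mult. assert (H1 := Cmod_ge_0 p). assert (H2 := Cmod_ge_0 y). nra. }
apply is_dseries_unique.
eapply is_dseries_ext; [|apply is_dseries_plus;
  apply is_dseries_scal, is_dseries_Psi1; assumption].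
intros l k. cbv beta.
assert (E : (1 - B) * qpoch (B * p) p l = qpoch B p l * (1 - B * p ^ l))
  by (rewrite <- qpoch_Sl; reflexivity).
rewrite Cpow_mult_l. unfold Cdiv.
(* All three coefficients share one denominator, so its inverse stays opaque and [ring] suffices. *)
match goal with |- context [/ ?d] => set (W := / d) end.
transitivity (qpoch A q (k + l) * ((1 - B) * qpoch (B * p) p l + B * qpoch B p l * p ^ l)
  * W * x ^ k * y ^ l); [ring|].
rewrite E. ring.
Qed.

(** Here [Cc] stands for p^(c-1). With C for [Cc], 1/(C;p)_(l+1) - 1/(Cp;p)_(l+1) = C (1 - p^(l+1))
    / ((1 - C) (Cp;p)_(l+1)); again 1 - p^(l+1) cancels against (p;p)_(l+1), and (Cp;p)_(l+1) = (1 -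
    Cp) (Cp^2;p)_l. *)
Lemma Psi1_shift_C (A B Cc D q p x y : C) :
  (Cmod q < 1)%R -> (Cmod p < 1)%R -> (Cmod x < 1)%R -> (Cmod y < 1)%R ->
  (forall n, 1 - Cc * p ^ n <> 0) -> (forall n, 1 - D * q ^ n <> 0) ->
  Psi1 A B Cc D q p x y
  = Psi1 A B (Cc * p) D q p x y
    + Cc * (1 - A) * (1 - B) * y / ((1 - Cc) * (1 - Cc * p))
      * Psi1 (A * q) (B * p) (Cc * p * p) D q p x y.
Proof.
intros Hq Hp Hx Hy HC HD.
assert (Hqq := one_minus_pow_neq_0 q Hq).
assert (Hpp := one_minus_pow_neq_0 p Hp).
assert (HC1 := shift_nonvanishing Cc p HC).
assert (HC2 := shift_nonvanishing (Cc * p) p HC1).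
assert (HC0 : 1 - Cc <> 0).
{ intros E. apply (HC O). simpl. rewrite <- E. ring. }
assert (HC10 : 1 - Cc * p <> 0).
{ intros E. apply (HC1 O). simpl. rewrite <- E. ring. }
apply is_dseries_unique.
eapply is_dseries_ext; [|apply is_dseries_plus;
  [apply is_dseries_Psi1; assumption
  |apply is_dseries_scal, is_dseries_shift_rows, is_dseries_Psi1; assumption]].
intros l k. cbv beta.
assert (N1 := qpoch_neq_0 D q HD k).
assert (N2 := qpoch_neq_0 q q Hqq k).
destruct l as [|l]; unfold shift_rows; [simpl; ring|].
(* Taking the first or the last factor off (Cp;p)_(l+1) expresses (Cp;p)_l by (Cp^2;p)_l, so that
   [field] meets only one symbol in C. *)
assert (E : qpoch (Cc * p) p l
  = (1 - Cc * p) * qpoch (Cc * p * p) p l / (1 - Cc * p * p ^ l)).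
{ rewrite <- qpoch_Sl. simpl. field. apply HC1. }
rewrite Nat.add_succ_r, (qpoch_Sl A), (qpoch_Sl B), (qpoch_Sl Cc), E, (qpoch_Sl (Cc * p)).
assert (N3 := qpoch_neq_0 p p Hpp l).
assert (N4 := qpoch_neq_0 (Cc * p * p) p HC2 l).
specialize (Hpp l). specialize (HC1 l).
simpl. field. repeat split; assumption.
Qed.

(** * Reduction of Psi_2 to Psi_1 *)

Lemma qpoch_0 (q : C) (n : nat) : qpoch 0 q n = 1.
Proof. induction n as [|n IH]; simpl; [|rewrite IH]; ring. Qed.

Lemma Psi2_Psi1 (A B Cc q p x y : C) :
  (Cmod q < 1)%R -> (Cmod p < 1)%R -> (Cmod x < 1)%R -> (Cmod y < 1)%R ->
  (forall n, 1 - B * p ^ n <> 0) -> (forall n, 1 - Cc * q ^ n <> 0) ->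
  Psi2 A B Cc q p x y = Psi1 A 0 B Cc q p x y.
Proof.
intros Hq Hp Hx Hy HB HC.
apply is_dseries_unique.
eapply is_dseries_ext; [|apply is_dseries_Psi1; assumption].
intros l k. cbv beta. rewrite qpoch_0, Cmult_1_r. reflexivity.
Qed.

Lemma Psi2_shift_B (A B Cc q p x y : C) :
  (Cmod q < 1)%R -> (Cmod p < 1)%R -> (Cmod x < 1)%R -> (Cmod y < 1)%R ->
  (forall n, 1 - B * p ^ n <> 0) -> (forall n, 1 - Cc * q ^ n <> 0) ->
  Psi2 A B Cc q p x y
  = Psi2 A (B * p) Cc q p x y
    + B * (1 - A) * y / ((1 - B) * (1 - B * p))
      * Psi2 (A * q) (B * p * p) Cc q p x y.
Proof.
intros Hq Hp Hx Hy HB HC.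
assert (HB1 := shift_nonvanishing B p HB).
assert (HB2 := shift_nonvanishing (B * p) p HB1).
rewrite !Psi2_Psi1, Psi1_shift_C by assumption.
(* The parameter B = 0 is fixed by B -> Bp, so the shifted function is again a [Psi2], and the
   factor 1 - B becomes 1. *)
replace (0 * p) with (RtoC 0) by ring.
replace (B * (1 - A) * (1 - 0) * y) with (B * (1 - A) * y) by ring.
reflexivity.
Qed.

(** * Complex powers of the bases, and passage from parameters to exponents *)

Lemma Cexp_plus (z w : C) : Cexp (z + w) = Cexp z * Cexp w.
Proof.
unfold Cexp, Cmult, Re, Im. simpl.
rewrite exp_plus, cos_plus, sin_plus. f_equal; ring.
Qed.

Lemma Cexp_0 : Cexp 0 = 1.
Proof.
unfold Cexp, Re, Im, RtoC. simpl. rewrite exp_0, cos_0, sin_0. f_equal; ring.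
Qed.

Lemma bpow_plus_1 (lq q a : C) : Cexp lq = q -> bpow lq (a + 1) = bpow lq a * q.
Proof.
intros <-. unfold bpow. rewrite <- Cexp_plus. f_equal. ring.
Qed.

Lemma bpow_minus_1 (lq q a : C) : Cexp lq = q -> bpow lq (a - 1) * q = bpow lq a.
Proof.
intros H. rewrite <- (bpow_plus_1 lq q _ H). f_equal. ring.
Qed.

Lemma bpow_opp_INR (lq q : C) (n : nat) :
  Cexp lq = q -> bpow lq (- INR n) * q ^ n = 1.
Proof.
intros H. induction n as [|n IH].
- unfold bpow. simpl. rewrite Cmult_1_r, <- Cexp_0. f_equal. ring.
- rewrite <- IH, S_INR, RtoC_plus.
  replace (- RtoC (INR n)) with (- (RtoC (INR n) + 1) + 1) by ring.
  rewrite (bpow_plus_1 lq q _ H). simpl. ring.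
Qed.

(** Converts the hypothesis on exponents into the form used above: a vanishing factor gives q^c q^n
    = 1 = q^(-n) q^n, and q^n, being invertible, cancels. *)
Lemma bpow_nonvanishing (lq q c : C) :
  Cexp lq = q -> (forall n : nat, bpow lq c <> bpow lq (- INR n)) ->
  forall n, 1 - bpow lq c * q ^ n <> 0.
Proof.
intros H Hc n E. apply (Hc n).
assert (E1 := bpow_opp_INR lq q n H).
assert (Hqn : q ^ n <> 0).
{ intros E0. rewrite E0, Cmult_0_r in E1. apply C1_nz. symmetry. exact E1. }
assert (E2 : bpow lq c * q ^ n = 1).
{ replace (bpow lq c * q ^ n) with (1 - (1 - bpow lq c * q ^ n)) by ring.
  rewrite E. ring. }
rewrite <- (Cmult_1_r (bpow lq c)), <- (Cmult_1_r (bpow lq (- INR n))).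
rewrite <- (Cinv_r _ Hqn), !Cmult_assoc, E1, E2. reflexivity.
Qed.

(** Factor 0 is the extra hypothesis, and factor n + 1 for c - 1 is factor n for c. *)
Lemma bpow_pred_nonvanishing (lq q c : C) :
  Cexp lq = q -> (forall n : nat, bpow lq c <> bpow lq (- INR n)) ->
  bpow lq (c - 1) <> 1 ->
  forall n, 1 - bpow lq (c - 1) * q ^ n <> 0.
Proof.
intros H Hc H1 [|n] E.
- apply H1. simpl in E.
  replace (bpow lq (c - 1)) with (1 - (1 - bpow lq (c - 1) * 1)) by ring.
  rewrite E. ring.
- apply (bpow_nonvanishing lq q c H Hc n). rewrite <- E.
  rewrite <- (bpow_minus_1 lq q c H). simpl. ring.
Qed.

Theorem theorem2p2 (q p lq lp x y : C)
  (hq : (0 < Cmod q < 1)%R) (hp : (0 < Cmod p < 1)%R)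
  (hlq : Cexp lq = q) (hlp : Cexp lp = p)
  (hx : (Cmod x < 1)%R) (hy : (Cmod y < 1)%R) :
  (forall a b c d : C,
     (forall n : nat, bpow lp c <> bpow lp (- INR n)) ->
     (forall n : nat, bpow lq d <> bpow lq (- INR n)) ->
     Psi1 (bpow lq a) (bpow lp (b + 1)) (bpow lp c) (bpow lq d) q p x y
     = Psi1 (bpow lq a) (bpow lp b) (bpow lp c) (bpow lq d) q p x y
       + bpow lp b * (1 - bpow lq a) * y / (1 - bpow lp c)
         * Psi1 (bpow lq (a + 1)) (bpow lp (b + 1)) (bpow lp (c + 1)) (bpow lq d)
             q p x y
     /\
     Psi1 (bpow lq a) (bpow lp b) (bpow lp c) (bpow lq d) q p x y
     = (1 - bpow lp b)
         * Psi1 (bpow lq a) (bpow lp (b + 1)) (bpow lp c) (bpow lq d) q p x y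
       + bpow lp b
         * Psi1 (bpow lq a) (bpow lp b) (bpow lp c) (bpow lq d) q p x (p * y)
     /\
     (bpow lp (c - 1) <> 1 ->
      Psi1 (bpow lq a) (bpow lp b) (bpow lp (c - 1)) (bpow lq d) q p x y
      = Psi1 (bpow lq a) (bpow lp b) (bpow lp c) (bpow lq d) q p x y
        + bpow lp (c - 1) * (1 - bpow lq a) * (1 - bpow lp b) * y
          / ((1 - bpow lp (c - 1)) * (1 - bpow lp c))
          * Psi1 (bpow lq (a + 1)) (bpow lp (b + 1)) (bpow lp (c + 1)) (bpow lq d)
              q p x y))
  /\
  (forall a b c : C,
     (forall n : nat, bpow lp b <> bpow lp (- INR n)) ->
     (forall n : nat, bpow lq c <> bpow lq (- INR n)) ->
     bpow lp (b - 1) <> 1 ->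
     Psi2 (bpow lq a) (bpow lp (b - 1)) (bpow lq c) q p x y
     = Psi2 (bpow lq a) (bpow lp b) (bpow lq c) q p x y
       + bpow lp (b - 1) * (1 - bpow lq a) * y
         / ((1 - bpow lp (b - 1)) * (1 - bpow lp b))
         * Psi2 (bpow lq (a + 1)) (bpow lp (b + 1)) (bpow lq c) q p x y).

Proof.
destruct hq as [_ hq], hp as [_ hp].
split.
- intros a b c d hc hd.
  assert (HC := bpow_nonvanishing lp p c hlp hc).
  assert (HD := bpow_nonvanishing lq q d hlq hd).
  rewrite !(bpow_plus_1 lq q) by exact hlq.
  rewrite !(bpow_plus_1 lp p) by exact hlp.
  split; [|split].
  + apply Psi1_shift_B; assumption.
  + apply Psi1_split_B; assumption.
  + intros hc1.
    (* Everything is expressed through p^(c-1): p^c becomes p^(c-1) p, and p^(c+1), already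
       rewritten as p^c p, becomes p^(c-1) p p. *)
    rewrite <- (bpow_minus_1 lp p c hlp).
    apply Psi1_shift_C; try assumption.
    apply bpow_pred_nonvanishing; assumption.
- intros a b c hb hc hb1.
  rewrite (bpow_plus_1 lq q) by exact hlq.
  rewrite (bpow_plus_1 lp p) by exact hlp.
  rewrite <- (bpow_minus_1 lp p b hlp).
  apply Psi2_shift_B; try assumption.
  + apply bpow_pred_nonvanishing; assumption.
  + apply bpow_nonvanishing; assumption.
Qed.
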